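(* Let $f_1,\ldots,f_m:\mathbb{R}^n\to\mathbb{R}^n$ be continuous maps with $f_i(0)=0$ for all $i$, and consider the nonlinear switched system $$x_{k+1}\in \mathrm{conv}\{f_1(x_k),\ldots,f_m(x_k)\}.$$ (i) If there exists a convex function $V:\mathbb{R}^n\to\mathbb{R}$ that satisfies $V(0)=0$, $V(x)>0$ for all $x\neq 0$, and $$V(f_i(x))<V(x),\quad \forall x\neq 0,\ \forall i\in\{1,\ldots,m\},$$ then the origin is globally asymptotically stable under arbitrary switching. (ii) If there exist a scalar $\beta>0$ and a convex function $V:\mathbb{R}^n\to\mathbb{R}$ that satisfies $V(0)=0$, $V(x)>0$ for all $x\neq 0$, and $$V(f_i(x))<V(x),\quad \forall x\neq 0 \text{ with } V(x)\leq\beta, \text{ and } \forall i\in\{1,\ldots,m\},$$ then the origin is locally asymptotically stable under arbitrary switching and the set $\{x\in\mathbb{R}^n \mid V(x)\leq\beta\}$ is a subset of the region of attraction of the origin.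
   Context: $\mathrm{conv}$ denotes the convex hull. A trajectory of the switched system is any sequence $(x_k)_{k\ge0}$ in $\mathbb{R}^n$ with $x_{k+1}\in \mathrm{conv}\{f_1(x_k),\ldots,f_m(x_k)\}$ for all $k$ (the element of the convex hull may be chosen arbitrarily at each step). The origin is stable in the sense of Lyapunov if for every $\epsilon>0$ there is $\delta>0$ such that every trajectory with $\|x_0\|\le\delta$ satisfies $\|x_k\|\le\epsilon$ for all $k$. The region of attraction of the origin (under arbitrary switching) is the set of initial conditions $x_0$ such that every trajectory starting at $x_0$ converges to the origin. The origin is locally (resp. globally) asymptotically stable under arbitrary switching if it is stable in the sense of Lyapunov and its region of attraction contains a neighborhood of the origin (resp. equals $\mathbb{R}^n$). *)

(* Defs.v *)
From HB Require Import structures.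
From mathcomp Require Import all_boot all_order all_algebra.
From mathcomp Require Import all_classical all_reals all_analysis.

Set Implicit Arguments.
Unset Strict Implicit.
Unset Printing Implicit Defensive.

Import Order.TTheory GRing.Theory Num.Theory.
Import numFieldNormedType.Exports.

Local Open Scope classical_set_scope.
Local Open Scope ring_scope.

Definition convex_hull (R : realType) (n : nat) (A : set 'rV[R]_n)
    : set 'rV[R]_n :=
  smallest (@convex_set R 'rV[R]_n) A.

(* The canonical norm `|x| on 'rV[R]_n is the sup norm; it induces the same
   topology as this one. *)
Definition euclidean_norm (R : realType) (n : nat) (x : 'rV[R]_n) : R :=
  Num.sqrt (\sum_(i < n) x ord0 i ^+ 2).

Definition trajectory (R : realType) (n m : nat)
    (f : 'I_m -> 'rV[R]_n -> 'rV[R]_n) (x : nat -> 'rV[R]_n) : Prop :=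
  forall k : nat, convex_hull [set f i (x k) | i in [set: 'I_m]] (x k.+1).

Definition lyapunov_stable (R : realType) (n m : nat)
    (f : 'I_m -> 'rV[R]_n -> 'rV[R]_n) : Prop :=
  forall eps : R, 0 < eps -> exists2 delta : R, 0 < delta &
    forall x : nat -> 'rV[R]_n, trajectory f x ->
      euclidean_norm (x 0%N) <= delta ->
      forall k : nat, euclidean_norm (x k) <= eps.

Definition region_of_attraction (R : realType) (n m : nat)
    (f : 'I_m -> 'rV[R]_n -> 'rV[R]_n) : set 'rV[R]_n :=
  [set x0 | forall x : nat -> 'rV[R]_n, trajectory f x -> x 0%N = x0 ->
    x @ \oo --> (0 : 'rV[R]_n)].

Definition locally_asymptotically_stable (R : realType) (n m : nat)
    (f : 'I_m -> 'rV[R]_n -> 'rV[R]_n) : Prop :=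
  lyapunov_stable f /\ nbhs (0 : 'rV[R]_n) (region_of_attraction f).

Definition globally_asymptotically_stable (R : realType) (n m : nat)
    (f : 'I_m -> 'rV[R]_n -> 'rV[R]_n) : Prop :=
  lyapunov_stable f /\ region_of_attraction f = [set: 'rV[R]_n].

(* Main.v *)
(* Sublevel sets of the convex function V are convex, so V decreases on the
   whole convex hull, not only at the points f_i(x).  V is continuous and, by
   convexity along rays from the origin, its sublevel sets are compact; hence on
   {eta <= V <= beta} every step lowers V by at least a fixed gap.  A trajectory
   therefore cannot stay in such a shell, V tends to 0 along it, and small values
   of V force small norms. *)
Require Import Defs.
From mathcomp Require Import all_boot all_order all_algebra.
From mathcomp Require Import all_classical all_reals all_analysis.
From mathcomp Require Import lra.

Set Implicit Arguments.
Unset Strict Implicit.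
Unset Printing Implicit Defensive.

Import Order.TTheory GRing.Theory Num.Theory.
Import numFieldNormedType.Exports.

Local Open Scope classical_set_scope.
Local Open Scope ring_scope.

(** * Elementary inequalities for convex functions *)

Lemma convex_function_comb (R : realType) (E : lmodType R) (V : E -> R) :
  convex_function [set: E] V ->
  forall (t : R) (x y : E), 0 <= t <= 1 ->
    V (t *: x + (1 - t) *: y) <= t * V x + (1 - t) * V y.
Proof.
move=> cV t x y /andP[t0 t1].
exact: (cV (Itv01 t0 t1) x y (mem_set I) (mem_set I)).
Qed.

Lemma convex_function_midpoint (R : realType) (E : lmodType R) (V : E -> R)
    (x y : E) :
  convex_function [set: E] V -> V (x + y) <= (V (2 *: x) + V (2 *: y)) / 2.
Proof.
move=> /convex_function_comb /(_ 2^-1 (2 *: x) (2 *: y)).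
have -> : 1 - 2^-1 = 2^-1 :> R by lra.
rewrite !scalerA mulVf ?pnatr_eq0// !scale1r => cV.
have t01 : 0 <= (2^-1 : R) <= 1 by apply/andP; split; lra.
have := cV t01; lra.
Qed.

Lemma convex_function_scale (R : realType) (E : lmodType R) (V : E -> R)
    (t : R) (x : E) :
  convex_function [set: E] V -> V 0 = 0 -> 0 <= t <= 1 -> V (t *: x) <= t * V x.
Proof.
move=> /convex_function_comb cV V0 /(cV t x 0).
by rewrite scaler0 addr0 V0 mulr0 addr0.
Qed.

(** Reduces continuity at [x] to continuity at 0 of a convex function vanishing there. *)
Lemma convex_function_translate (R : realType) (E : lmodType R) (V : E -> R)
    (x : E) :
  convex_function [set: E] V ->
  convex_function [set: E] (fun y => V (x + y) - V x).
Proof.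
move=> /convex_function_comb cV t y z _ _.
have t01 : 0 <= t%:num <= 1 by apply/andP; split.
have := cV t%:num (x + y) (x + z) t01.
rewrite !scalerDr addrACA -scalerDl subrKC scale1r => H.
rewrite convRE /=.
change (V (x + (t%:num *: (y : E) + (1 - t%:num) *: (z : E))) - V x <=
  t%:num * (V (x + y) - V x) + (1 - t%:num) * (V (x + z) - V x)).
lra.
Qed.

(** * Continuity and coercivity of convex functions in finite dimension *)

(** Induction on [s]: the midpoint inequality splits off one vector at the cost of doubling all
    coefficients, and convexity on the segments from 0 to [e j] and [- e j] bounds the term split
    off. *)
Lemma convex_function_span_le (R : realType) (E : lmodType R) (W : E -> R)
    (I : Type) (e : I -> E) (s : seq I) :
  convex_function [set: E] W -> W 0 = 0 ->
  exists2 C : R, 0 <= C & exists2 r : R, 0 < r &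
    forall (c : I -> R) (t : R), t <= r -> (forall i, `|c i| <= t) -> 0 <= t ->
      W (\sum_(i <- s) c i *: e i) <= C * t.
Proof.
move=> cW W0; elim: s => [|j s [C C0 [r r0 Cr]]].
  by exists 0 => //; exists 1 => // c t _ _ _; rewrite big_nil W0 mul0r.
pose M := Num.max 0 (Num.max (W (e j)) (W (- e j))).
have M0 : 0 <= M by rewrite le_max lexx.
exists (C + M); first exact: addr_ge0.
(* [r / 2] absorbs the doubling in the induction hypothesis; [1 / 2] gives [|2 * c j| <= 1], so that
   [2 * c j] acts as a convex weight on [e j] or [- e j], according to its sign. *)
exists (Num.min (r / 2) (1 / 2)); first by rewrite lt_min; apply/andP; split; lra.
move=> c t; rewrite le_min => /andP[tr t1] ct t0; rewrite big_cons.
apply: (le_trans (convex_function_midpoint _ _ cW)).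
have H1 : W (2 *: \sum_(i <- s) c i *: e i) <= C * (2 * t).
  rewrite scaler_sumr; under eq_bigr do rewrite scalerA.
  apply: Cr => [|i|]; [lra| |lra].
  by rewrite normrM ger0_norm// ler_wpM2l.
have H2 : W (2 *: (c j *: e j)) <= 2 * t * M.
  rewrite scalerA; apply: (@le_trans _ _ (`|2 * c j| * M)); last first.
    by rewrite ler_wpM2r// normrM ger0_norm// ler_wpM2l.
  have c1 : 0 <= `|2 * c j| <= 1.
    rewrite normr_ge0 normrM ger0_norm//=.
    have := ct j; lra.
  have [p|q] := leP 0 (2 * c j).
    rewrite ger0_norm// in c1 *.
    apply: (le_trans (convex_function_scale _ cW W0 c1)).
    by rewrite ler_wpM2l// /M !le_max lexx orbT.
  rewrite ltr0_norm// in c1 *.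
  rewrite -[_ *: _]opprK -scaleNr -scalerN.
  apply: (le_trans (convex_function_scale _ cW W0 c1)).
  apply: ler_wpM2l; first by case/andP: c1.
  by rewrite /M !le_max lexx !orbT.
nra.
Qed.

Lemma entry_le_norm (R : realType) (n : nat) (x : 'rV[R]_n) (i : 'I_n) :
  `|x ord0 i| <= `|x|.
Proof.
rewrite [leRHS]mx_normrE.
exact: (le_bigmax_cond _ (fun i : 'I_1 * 'I_n => `|x i.1 i.2|) (j := (ord0, i))).
Qed.

(** The increment [W] of [V] at [x] is bounded above linearly near 0 by expanding in the standard
    basis; the lower bound follows from [0 <= W y + W (- y)]. *)
Lemma convex_function_continuous (R : realType) (n : nat) (V : 'rV[R]_n -> R) :
  convex_function [set: 'rV[R]_n] V -> continuous V.
Proof.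
move=> cV x.
pose W y := V (x + y) - V x.
have cW : convex_function [set: 'rV[R]_n] W by exact: convex_function_translate.
have W0 : W 0 = 0 by rewrite /W addr0 subrr.
have [C C0 [r r0 Cr]] := convex_function_span_le
  (fun j : 'I_n => delta_mx ord0 j) (index_enum 'I_n) cW W0.
have Wle y : `|y| <= r -> W y <= C * `|y|.
  move=> yr; rewrite [y in W y]row_sum_delta; apply: Cr => // i.
  exact: entry_le_norm.
have absW y : `|y| <= r -> `|W y| <= C * `|y|.
  move=> yr; rewrite ler_norml (Wle _ yr) andbT.
  have := convex_function_midpoint (2^-1 *: y) (- (2^-1 *: y)) cW.
  rewrite subrr W0 scalerN scalerA mulfV ?pnatr_eq0// scale1r.
  have := Wle (- y); rewrite normrN => /(_ yr); lra.
apply/(@cvgrPdist_le _ _ _ (nbhs x) (nbhs_filter x)) => e e0.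
(* [C + 1] instead of [C] because [C] may vanish. *)
have d0 : 0 < Num.min r (e / (C + 1)).
  by rewrite lt_min r0 divr_gt0// ltr_wpDl.
near=> y.
have : `|y - x| <= Num.min r (e / (C + 1)).
  rewrite distrC; near: y.
  apply/nbhs_ballP; exists (Num.min r (e / (C + 1))) => //= z.
  by rewrite -ball_normE /= => /ltW.
rewrite le_min => /andP[yr ye].
have -> : V x - V y = - W (y - x) by rewrite /W subrKC opprB.
rewrite normrN; apply: (le_trans (absW _ yr)).
apply: (@le_trans _ _ ((C + 1) * `|y - x|)); first by rewrite ler_wpM2r// lerDl.
by rewrite mulrC -ler_pdivlMr//; lra.
Unshelve. all: by end_near. Qed.

(* Along rays a convex [V] with [V 0 = 0] grows at least linearly, so its
   positive minimum on the sphere of radius [eps] controls it outside. *)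
Lemma convex_function_coercive (R : realType) (n : nat) (V : 'rV[R]_n -> R) :
  convex_function [set: 'rV[R]_n] V -> V 0 = 0 ->
  (forall x, x <> 0 -> 0 < V x) ->
  forall eps : R, 0 < eps ->
  exists2 mu : R, 0 < mu & forall x, eps <= `|x| -> mu * `|x| <= V x.
Proof.
move=> cV V0 Vpos eps e0.
pose S := [set x : 'rV[R]_n | `|x| = eps].
(* If the sphere is empty, as for [n = 0], no vector has norm at least [eps], since rescaling it
   would give a point of [S]; any [mu] then works. *)
have [S0|/set0P/negP/negPn/eqP S0] := pselect (S !=set0); last first.
  exists 1 => // x xe; have x0 : 0 < `|x| by exact: lt_le_trans xe.
  suff : S ((eps / `|x|) *: x) by rewrite S0.
  rewrite /S/= normrZ ger0_norm ?divfK ?gt_eqF//.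
  by rewrite divr_ge0// ltW.
have cS : compact S.
  apply: bounded_closed_compact.
    exists eps; split; first exact: gtr0_real.
    by move=> M eM x /= ->; exact: ltW.
  have -> : S = (@Num.norm _ 'rV[R]_n) @^-1` [set eps] by [].
  apply: closed_comp => [x _|]; first exact: norm_continuous.
  exact: closed_eq.
have [c cS' cmin] : exists2 c, c \in S & forall t, t \in S -> V c <= V t.
  apply: EVT_min_rV => //.
  by apply: continuous_subspaceT; exact: convex_function_continuous.
have Vc : 0 < V c.
  apply: Vpos => c0; move: cS'; rewrite inE /S/= c0 normr0 => e.
  by rewrite -e ltxx in e0.
exists (V c / eps); first exact: divr_gt0.
move=> x xe; have x0 : 0 < `|x| by exact: lt_le_trans xe.
have t01 : 0 <= eps / `|x| <= 1.
  apply/andP; split; first by rewrite divr_ge0// ltW.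
  by rewrite ler_pdivrMr// mul1r.
have /cmin H : (eps / `|x|) *: x \in S.
  rewrite inE /S/= normrZ ger0_norm ?divfK ?gt_eqF//.
  by case/andP: t01.
have := le_trans H (convex_function_scale x cV V0 t01).
by rewrite mulrAC ler_pdivlMr// mulrAC ler_pdivrMr// [V x * _]mulrC.
Qed.

(** * Convex hulls and comparison of norms *)

(** The sublevel set of [V] at [c] is convex and contains [A], hence contains the smallest such
    set. *)
Lemma convex_hull_le (R : realType) (n : nat) (V : 'rV[R]_n -> R)
    (A : set 'rV[R]_n) (c : R) :
  convex_function [set: 'rV[R]_n] V -> (forall y, A y -> V y <= c) ->
  forall y, convex_hull A y -> V y <= c.
Proof.
move=> cV Ac y hy.
have := @smallest_sub _ (@convex_set R 'rV[R]_n) A [set y | V y <= c].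
apply => // u v t; rewrite !inE /= => uc vc.
apply: (le_trans (cV t u v (mem_set I) (mem_set I))).
rewrite convRE; change (t%:num * V u + (1 - t%:num) * V v <= c).
have t0 : 0 <= t%:num :> R by [].
have t1 : t%:num <= 1 :> R by [].
nra.
Qed.


Lemma euclidean_norm_ge (R : realType) (n : nat) (x : 'rV[R]_n) :
  `|x| <= euclidean_norm x.
Proof.
rewrite [leLHS]mx_normrE; apply/bigmax_leP; split=> [|[i j] _ /=].
  exact: sqrtr_ge0.
rewrite ord1 -sqrtr_sqr ler_wsqrtr// (bigD1 j)//= lerDl.
by apply: sumr_ge0 => k _; exact: sqr_ge0.
Qed.

(** A crude constant suffices for equivalence of the norms; [n.+1] stays positive when [n = 0], so
    it can be divided by. *)
Lemma euclidean_norm_le (R : realType) (n : nat) (x : 'rV[R]_n) :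
  euclidean_norm x <= n.+1%:R * `|x|.
Proof.
rewrite -[leRHS]ger0_norm ?mulr_ge0// -sqrtr_sqr ler_wsqrtr//.
apply: (@le_trans _ _ (\sum_(i < n) `|x| ^+ 2)).
  apply: ler_sum => i _; rewrite -[leLHS]real_normK ?num_real//.
  by rewrite lerXn2r ?nnegrE// entry_le_norm.
rewrite sumr_const card_ord -[_ *+ n]mulr_natl exprMn ler_wpM2r ?sqr_ge0//.
by rewrite -natrX ler_nat (leq_trans (leqnSn n))// -mulnn leq_pmull.
Qed.

(** * Decrease of a Lyapunov function along trajectories *)

(** Serves both parts of the theorem: a globally decreasing [V] satisfies it for every [beta]. *)
Definition lyapunov_below (R : realType) (n m : nat)
    (f : 'I_m -> 'rV[R]_n -> 'rV[R]_n) (beta : R) (V : 'rV[R]_n -> R) : Prop :=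
  [/\ convex_function [set: 'rV[R]_n] V, V 0 = 0,
      forall x, x <> 0 -> 0 < V x &
      forall x (i : 'I_m), x <> 0 -> V x <= beta -> V (f i x) < V x].

Lemma lyapunov_below_ge0 (R : realType) (n m : nat)
    (f : 'I_m -> 'rV[R]_n -> 'rV[R]_n) (beta : R) (V : 'rV[R]_n -> R) x :
  lyapunov_below f beta V -> 0 <= V x.
Proof.
move=> [_ V0 Vpos _].
by have [->|/eqP/Vpos/ltW//] := eqVneq x 0; rewrite V0.
Qed.

Lemma trajectory_step (R : realType) (n m : nat)
    (f : 'I_m -> 'rV[R]_n -> 'rV[R]_n) (V : 'rV[R]_n -> R) x k c :
  convex_function [set: 'rV[R]_n] V -> trajectory f x ->
  (forall i, V (f i (x k)) <= c) -> V (x k.+1) <= c.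
Proof.
move=> cV tx Vc; apply: (convex_hull_le cV) (tx k).
by move=> _ [i _ <-].
Qed.

(** By induction the trajectory stays in the sublevel set at [beta], where the decrease condition
    applies; at the state 0 the fixed point property replaces it. *)
Lemma trajectory_lyapunov_le (R : realType) (n m : nat)
    (f : 'I_m -> 'rV[R]_n -> 'rV[R]_n) (beta : R) (V : 'rV[R]_n -> R) x j k :
  (forall i, f i 0 = 0) -> lyapunov_below f beta V -> trajectory f x ->
  V (x j) <= beta -> (j <= k)%N -> V (x k) <= V (x j).
Proof.
move=> f0 [cV V0 Vpos Vdec] tx xj /subnK <-.
elim: (k - j)%N => // l IH.
rewrite addSn; apply: (trajectory_step cV tx) => // i; apply: (le_trans _ IH).
have [->|/eqP xl] := eqVneq (x (l + j)%N) 0; first by rewrite f0.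
by apply: ltW; apply: Vdec => //; exact: le_trans IH _.
Qed.

(* The gap [V x - V (f i x)] is positive and continuous on the compact shell. *)
Lemma lyapunov_gap (R : realType) (n m : nat)
    (f : 'I_m -> 'rV[R]_n -> 'rV[R]_n) (beta eta : R) (V : 'rV[R]_n -> R) :
  (forall i, continuous (f i)) -> lyapunov_below f beta V -> 0 < eta ->
  exists2 g : R, 0 < g &
    forall x i, eta <= V x -> V x <= beta -> V (f i x) <= V x - g.
Proof.
move=> fc [cV V0 Vpos Vdec] eta0.
pose K := [set x | V x \in `[eta, beta]].
have Vc := convex_function_continuous cV.
have cK : compact K.
  apply: bounded_closed_compact.
    have [mu mu0 muV] := convex_function_coercive cV V0 Vpos ltr01.
    (* Outside the unit ball, coercivity gives [mu * |x| <= V x <= beta]. *)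
    exists (Num.max 1 (beta / mu)); split; first exact: num_real.
    move=> M; rewrite gt_max => /andP[M1 bM] x /=.
    rewrite /K/= in_itv/= => /andP[_ Vb].
    have [x1|/ltW x1] := leP `|x| 1; first exact: le_trans (ltW M1).
    apply: le_trans (ltW bM); rewrite ler_pdivlMr// mulrC.
    exact: le_trans (muV _ x1) Vb.
  have -> : K = V @^-1` [set` `[eta, beta]] by [].
  apply: closed_comp => [x _|]; first exact: Vc.
  exact: interval_closed.
have gap i : exists2 g : R, 0 < g &
    forall x, x \in K -> V (f i x) <= V x - g.
  have [K0|/set0P/negP/negPn/eqP K0] := pselect (K !=set0); last first.
    by exists 1 => // x; rewrite K0 in_set0.
  have [c cK' cmin] : exists2 c, c \in K &
      forall t, t \in K -> V c - V (f i c) <= V t - V (f i t).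
    apply: EVT_min_rV => //; apply: continuous_subspaceT => x.
    exact: (continuousB (Vc x) (continuous_comp (fc i x) (Vc (f i x)))).
  exists (V c - V (f i c)); last by move=> x /cmin; lra.
  rewrite subr_gt0; move: cK'; rewrite inE /K/= in_itv/= => /andP[ec cb].
  apply: Vdec => // c0; move: ec; rewrite c0 V0; lra.
have /choice[g gP] : forall i, exists g : R, 0 < g /\
    forall x, x \in K -> V (f i x) <= V x - g.
  by move=> i; have [g] := gap i; exists g.
(* The default 1 keeps the gap positive when there are no maps. *)
exists (\big[Num.min/1]_i g i).
  by apply/bigmin_gtP; split=> // i _; have [] := gP i.
move=> x i ex xb; have [_ /(_ x)] := gP i.
rewrite inE /K/= in_itv/= ex xb => /(_ isT)/le_trans; apply.
rewrite lerD2l lerN2; exact: bigmin_le_cond.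
Qed.

(** * Attraction and stability *)

Lemma lyapunov_below_attraction (R : realType) (n m : nat)
    (f : 'I_m -> 'rV[R]_n -> 'rV[R]_n) (beta : R) (V : 'rV[R]_n -> R) :
  (forall i, continuous (f i)) -> (forall i, f i 0 = 0) ->
  lyapunov_below f beta V ->
  [set x | V x <= beta] `<=` region_of_attraction f.
Proof.
move=> fc f0 LV x0 /= Vx0 x tx xx0; rewrite -xx0 in Vx0.
have [cV V0 Vpos _] := LV.
have Vb k : V (x k) <= beta.
  exact: le_trans (trajectory_lyapunov_le f0 LV tx Vx0 (leq0n k)) Vx0.
have small eta : 0 < eta -> exists k, V (x k) < eta.
  (* If [V] stayed at or above [eta], each step would lose at least [g], and [V] would eventually be
     negative. *)
  move=> eta0; apply/not_existsP => big.
  have {}big k : eta <= V (x k) by rewrite leNgt; apply/negP/big.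
  have [g g0 gV] := lyapunov_gap fc LV eta0.
  have dec k : V (x k) <= V (x 0%N) - g * k%:R.
    elim: k => [|k IH]; first by rewrite mulr0 subr0.
    apply: (@le_trans _ _ (V (x k) - g)).
      by apply: (trajectory_step cV tx) => i; exact: gV.
    by rewrite -natr1; lra.
  pose k := Num.bound (V (x 0%N) / g).
  have := archi_boundP (divr_ge0 (lyapunov_below_ge0 (x 0%N) LV) (ltW g0)).
  rewrite -/k ltr_pdivrMr// => kg.
  have := dec k; have := big k; lra.
apply/cvgrPdist_lt => e e0.
have [mu mu0 muV] := convex_function_coercive cV V0 Vpos e0.
(* Once [V] is below [mu * e] it stays there by monotonicity, whereas a norm of at least [e] would
   force [V] to be at least [mu * e]. *)
have [k kV] := small (mu * e) (mulr_gt0 mu0 e0).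
exists k => // j /= kj; rewrite sub0r normrN ltNge; apply/negP => ex.
have := le_lt_trans (trajectory_lyapunov_le f0 LV tx (Vb k) kj) kV.
by apply/negP; rewrite -leNgt (le_trans _ (muV _ ex))// ler_wpM2l// ltW.
Qed.

Lemma lyapunov_below_nbhs (R : realType) (n m : nat)
    (f : 'I_m -> 'rV[R]_n -> 'rV[R]_n) (beta eta : R) (V : 'rV[R]_n -> R) :
  lyapunov_below f beta V -> 0 < eta -> \forall x \near (0 : 'rV[R]_n), V x <= eta.
Proof.
move=> [cV V0 _ _] eta0.
have /cvgrPdist_le/(_ _ eta0) := convex_function_continuous cV (x := 0).
rewrite V0; apply: filterS => x; rewrite sub0r normrN; apply: le_trans.
exact: ler_norm.
Qed.

(** A small sublevel set of [V] is a neighborhood of 0, traps trajectories, and by coercivity lies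
    in the prescribed ball. *)
Lemma lyapunov_below_stable (R : realType) (n m : nat)
    (f : 'I_m -> 'rV[R]_n -> 'rV[R]_n) (beta : R) (V : 'rV[R]_n -> R) :
  (forall i, f i 0 = 0) -> 0 < beta -> lyapunov_below f beta V ->
  lyapunov_stable f.
Proof.
move=> f0 beta0 LV eps eps0; have [cV V0 Vpos _] := LV.
pose e := eps / n.+1%:R.
have e0 : 0 < e by rewrite divr_gt0.
have [mu mu0 muV] := convex_function_coercive cV V0 Vpos e0.
(* The bound [beta] makes monotonicity available; the factor 1/2 keeps [V] strictly below
   [mu * e]. *)
have eta0 : 0 < Num.min beta (mu * e / 2).
  by rewrite lt_min beta0 !(divr_gt0, mulr_gt0).
have /nbhs_ballP[d /= d0 dV] := lyapunov_below_nbhs LV eta0.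
(* Halved because the ball of radius [d] is open while the bound by [delta] is not strict. *)
exists (d / 2); first exact: divr_gt0.
move=> x tx xd k.
have : V (x 0%N) <= Num.min beta (mu * e / 2).
  apply: dV; rewrite -ball_normE /= sub0r normrN.
  apply: le_lt_trans (euclidean_norm_ge _) _; lra.
rewrite le_min => /andP[xb xe].
have xk := le_trans (trajectory_lyapunov_le f0 LV tx xb (leq0n k)) xe.
apply: le_trans (euclidean_norm_le _) _.
rewrite mulrC -ler_pdivlMr// -/e leNgt; apply/negP => /ltW ex.
have := muV _ ex; have := ler_wpM2l (ltW mu0) ex.
have := mulr_gt0 mu0 e0; lra.
Qed.

Theorem proposition4p2 (R : realType) (n m : nat)
    (f : 'I_m -> 'rV[R]_n -> 'rV[R]_n)
    (f_cont : forall i : 'I_m, continuous (f i))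
    (f_zero : forall i : 'I_m, f i 0 = 0) :
  (forall V : 'rV[R]_n -> R,
      convex_function [set: 'rV[R]_n] V ->
      V 0 = 0 ->
      (forall x : 'rV[R]_n, x <> 0 -> 0 < V x) ->
      (forall (x : 'rV[R]_n) (i : 'I_m), x <> 0 -> V (f i x) < V x) ->
    globally_asymptotically_stable f)
  /\
  (forall (beta : R) (V : 'rV[R]_n -> R),
      0 < beta ->
      convex_function [set: 'rV[R]_n] V ->
      V 0 = 0 ->
      (forall x : 'rV[R]_n, x <> 0 -> 0 < V x) ->
      (forall (x : 'rV[R]_n) (i : 'I_m),
         x <> 0 -> V x <= beta -> V (f i x) < V x) ->
    locally_asymptotically_stable f /\
    [set x : 'rV[R]_n | V x <= beta] `<=` region_of_attraction f).
Proof.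
split=> [V cV V0 Vpos Vdec|beta V beta0 cV V0 Vpos Vdec].
  have LV beta : lyapunov_below f beta V by split=> // x i /Vdec.
  split; first exact: lyapunov_below_stable f_zero ltr01 (LV 1).
  apply/seteqP; split=> // x _.
  (* The choice [beta = V x] places an arbitrary initial point in the sublevel set. *)
  exact: (lyapunov_below_attraction f_cont f_zero (LV (V x)) (lexx (V x))).
have LV : lyapunov_below f beta V by [].
have attr := lyapunov_below_attraction f_cont f_zero LV.
split=> //; split; first exact: lyapunov_below_stable f_zero beta0 LV.
exact: filterS attr (lyapunov_below_nbhs LV beta0).
Qed.
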